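(* Let $E$ be a Banach lattice. If the closed unit ball $B_{E^*}$ of $E^*$ is absolutely weak$^*$ compact, then $E$ has order continuous norm.
   Context: Banach lattices are real; $E^*$ denotes the topological dual of $E$. The absolute weak$^*$ topology $|\sigma|(E^*,E)$ on $E^*$ is the locally convex-solid topology generated by the lattice seminorms $q_x(x^* ) = |x^*|(|x|)$, $x^* \in E^*$, where $x$ ranges over $E$. A subset of $E^*$ is absolutely weak$^*$ compact if it is compact for $|\sigma|(E^*,E)$. *)

(* Defs.v *)
From HB Require Import structures.
From mathcomp Require Import all_boot all_order all_algebra.
From mathcomp Require Import all_classical all_reals topology normedtype.

Set Implicit Arguments.
Unset Strict Implicit.
Unset Printing Implicit Defensive.

Import Order.TTheory GRing.Theory Num.Theory.
Import numFieldNormedType.Exports.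

Local Open Scope classical_set_scope.
Local Open Scope ring_scope.

(* The order of a vector lattice is carried by its own mixin: Num.NumDomain
   already sits above both Order.Preorder and the normed structures, so
   Hierarchy-Builder refuses a new structure joining porderType with
   normedModType. *)
HB.mixin Record Lmodule_isVectorLattice (R : realType) E of GRing.Lmodule R E := {
  vle : E -> E -> Prop;
  vle_refl : forall x : E, vle x x;
  vle_anti : forall x y : E, vle x y -> vle y x -> x = y;
  vle_trans : forall y x z : E, vle x y -> vle y z -> vle x z;
  vle_add2r : forall z x y : E, vle x y -> vle (x + z) (y + z);
  vscaler_ge0 : forall (a : R) (x : E), 0 <= a -> vle 0 x -> vle 0 (a *: x);
  vjoin : E -> E -> E;
  vjoin_ubl : forall x y : E, vle x (vjoin x y);
  vjoin_ubr : forall x y : E, vle y (vjoin x y);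
  vjoin_least : forall x y z : E, vle x z -> vle y z -> vle (vjoin x y) z
}.

#[short(type="vectorLatticeType")]
HB.structure Definition VectorLattice (R : realType) :=
  { E of GRing.Lmodule R E & Lmodule_isVectorLattice R E }.

Notation "x <=v y" := (vle x y) (at level 70, no associativity) : ring_scope.

Arguments vle_trans {R s y x z}.
Arguments vle_anti {R s x y}.
Arguments vle_add2r {R s} z {x y}.
Arguments vscaler_ge0 {R s a x}.
Arguments vjoin_least {R s x y z}.

Definition vabs (R : realType) (E : vectorLatticeType R) (x : E) : E :=
  vjoin x (- x).

HB.mixin Record VectorLattice_isBanachLattice (R : realType) E
    of CompleteNormedModule R E & VectorLattice R E := {
  lattice_norm : forall x y : E, vabs x <=v vabs y -> `|x| <= `|y|
}.

#[short(type="banachLatticeType")]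
HB.structure Definition BanachLattice (R : realType) :=
  { E of CompleteNormedModule R E & VectorLattice R E
       & VectorLattice_isBanachLattice R E }.

Section vector_lattice_theory.
Context {R : realType} {E : vectorLatticeType R}.
Implicit Types x y z : E.

Definition vpos x : E := vjoin x 0.

Lemma vle_add2l z x y : x <=v y -> z + x <=v z + y.
Proof. by rewrite ![z + _]addrC; exact: vle_add2r. Qed.

Lemma vle_add x y z t : x <=v y -> z <=v t -> x + z <=v y + t.
Proof. by move=> xy zt; apply: (vle_trans (vle_add2r z xy)); exact: vle_add2l. Qed.

Lemma vsubr_ge0 x y : (0 <=v y - x) <-> (x <=v y).
Proof.
by split=> [/(vle_add2r x)|/(vle_add2r (- x))]; rewrite ?subrr ?add0r ?subrK.
Qed.

Lemma voppr_le x y : x <=v y -> - y <=v - x.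
Proof. by move=> xy; apply/vsubr_ge0; rewrite opprK addrC; exact/vsubr_ge0. Qed.

Lemma vaddr_ge0 x y : 0 <=v x -> 0 <=v y -> 0 <=v x + y.
Proof. by move=> x0 y0; rewrite -[0]addr0; exact: vle_add. Qed.

Lemma vscaler_le (a : R) x y : 0 <= a -> x <=v y -> a *: x <=v a *: y.
Proof.
by move=> a0 /vsubr_ge0 xy; apply/vsubr_ge0; rewrite -scalerBr; exact: vscaler_ge0.
Qed.

Lemma vpos_ge0 x : 0 <=v vpos x. Proof. exact: vjoin_ubr. Qed.

Lemma vposB x : vpos x - vpos (- x) = x.
Proof.
apply/eqP; rewrite subr_eq addrC; apply/eqP/vle_anti.
  apply: vjoin_least; first by rewrite -[X in X <=v _]add0r; apply/vle_add2r/vpos_ge0.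
  by rewrite -(addNr x); apply/vle_add2r; exact: vjoin_ubl.
rewrite -[X in _ <=v X](subrK x); apply: vle_add2r; apply: vjoin_least.
  by rewrite -[X in X <=v _]add0r; exact/vle_add2r/vpos_ge0.
by apply/vsubr_ge0; exact: vjoin_ubl.
Qed.

Lemma vabs_ge0 x : 0 <=v vabs x.
Proof.
have : 0 <=v vabs x + vabs x.
  by rewrite -(subrr x); apply: vle_add; [exact: vjoin_ubl|exact: vjoin_ubr].
have a0 : 0 <= 2^-1 :> R by rewrite invr_ge0.
move=> /(vscaler_ge0 a0); rewrite -mulr2n -[vabs x *+ 2]scaler_nat scalerA.
by rewrite mulVf ?scale1r// pnatr_eq0.
Qed.

Lemma ge0_vabs x : 0 <=v x -> vabs x = x.
Proof.
move=> x0; apply: vle_anti; last exact: vjoin_ubl.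
apply: vjoin_least; first exact: vle_refl.
by apply: (vle_trans _ x0); rewrite -oppr0; exact: voppr_le.
Qed.

Lemma vpos_le_vabs x : vpos x <=v vabs x.
Proof. by apply: vjoin_least; [exact: vjoin_ubl|exact: vabs_ge0]. Qed.

Lemma vabsN x : vabs (- x) = vabs x.
Proof.
rewrite /vabs opprK; apply: vle_anti; apply: vjoin_least;
  by [exact: vjoin_ubl|exact: vjoin_ubr].
Qed.

Lemma riesz_decomposition x y z : 0 <=v x -> 0 <=v y -> 0 <=v z -> z <=v x + y ->
  exists2 u, 0 <=v u /\ u <=v x & 0 <=v z - u /\ z - u <=v y.
Proof.
move=> x0 y0 z0 zxy; exists (z - vpos (z - x)).
  split.
    apply/vsubr_ge0; apply: vjoin_least => //.
    by rewrite -[X in _ <=v X]addr0; apply: vle_add2l; rewrite -oppr0; exact: voppr_le.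
  have /(vle_add2r (x - vpos (z - x))) : z - x <=v vpos (z - x) by exact: vjoin_ubl.
  by rewrite addrA subrK addrCA subrr addr0.
rewrite opprB addrCA subrr addr0; split; first exact: vpos_ge0.
apply: vjoin_least => //.
by move: zxy => /(vle_add2r (- x)); rewrite addrAC subrr add0r.
Qed.

End vector_lattice_theory.

Definition dual_pred (R : realType) (E : normedModType R) : {pred E -> R} :=
  mem [set f : E -> R | linear f /\ continuous f].

Record dual (R : realType) (E : normedModType R) := Dual {
  dual_fun :> E -> R;
  dual_funP : dual_fun \in @dual_pred R E }.

Section dual_lmodType.
Context {R : realType} {E : normedModType R}.
Implicit Types f g : dual E.

HB.instance Definition _ := [isSub for @dual_fun R E].
HB.instance Definition _ := [Choice of dual E by <:].

Lemma dual_submod_closed : submod_closed (@dual_pred R E).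
Proof.
split=> [|a f g].
  by rewrite inE; split=> [b x y|]; [rewrite scaler0 addr0|exact: cst_continuous].
rewrite !inE => -[lf cf] [lg cg]; split=> [b x y|x].
  by rewrite /= !fctE lf lg !scalerDr !scalerA [a * b]mulrC addrACA.
by apply: cvgD; [apply: cvgZ; [exact: cvg_cst|exact: cf]|exact: cg].
Qed.

HB.instance Definition _ := GRing.isSubmodClosed.Build R (E -> R) (@dual_pred R E)
  dual_submod_closed.
HB.instance Definition _ := [SubChoice_isSubLmodule of dual E by <:].

Lemma dual_linear f : linear f.
Proof. by have := dual_funP f; rewrite inE => -[]. Qed.

Lemma dual_continuous f : continuous f.
Proof. by have := dual_funP f; rewrite inE => -[]. Qed.

HB.instance Definition _ f := GRing.isLinear.Build R E R *:%R f (@dual_linear f).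

Lemma dual_eqP f g : f =1 g -> f = g.
Proof. by move=> fg; apply/val_inj/funext. Qed.

Lemma dual_addE f g x : (f + g) x = f x + g x. Proof. by []. Qed.

Lemma dual_oppE f x : (- f) x = - f x. Proof. by []. Qed.

Lemma dual_scaleE (a : R) f x : (a *: f) x = a * f x. Proof. by []. Qed.

Lemma dual_bounded f : exists2 M, 0 <= M & forall x, `|f x| <= M * `|x|.
Proof.
have /linear_bounded_continuous/linear_boundedP := @dual_continuous f.
by move=> /pinfty_ex_gt0[M M0 Mf]; exists M => //; exact: ltW.
Qed.

Definition dual_norm f : R := sup [set `|f x| | x in [set x : E | `|x| <= 1]].

End dual_lmodType.

Section dual_lattice.
Context {R : realType} {E : banachLatticeType R}.
Implicit Types (f g h : dual E) (x y z : E).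

Definition dual_le f g : Prop := forall x, 0 <=v x -> f x <= g x.

Lemma dual_le_refl f : dual_le f f. Proof. by move=> x _. Qed.

Lemma dual_le_anti f g : dual_le f g -> dual_le g f -> f = g.
Proof.
move=> fg gf; apply: dual_eqP => x; rewrite -(vposB x) !linearB/=.
by congr (_ - _); apply/le_anti; rewrite fg ?gf//; exact: vpos_ge0.
Qed.

Lemma dual_le_trans g f h : dual_le f g -> dual_le g h -> dual_le f h.
Proof. by move=> fg gh x x0; exact: le_trans (fg x x0) (gh x x0). Qed.

Lemma dual_le_add2r h f g : dual_le f g -> dual_le (f + h) (g + h).
Proof. by move=> fg x x0; rewrite !dual_addE lerD2r fg. Qed.

Lemma dual_scaler_ge0 (a : R) f : 0 <= a -> dual_le 0 f -> dual_le 0 (a *: f).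
Proof.
by move=> a0 f0 x x0; rewrite dual_scaleE mulr_ge0//; exact: f0.
Qed.

Lemma banach_norm_le x y : 0 <=v x -> x <=v y -> `|x| <= `|y|.
Proof.
move=> x0 xy; have y0 := vle_trans x0 xy.
by apply: lattice_norm; rewrite !ge0_vabs.
Qed.

Lemma norm_vabs x : `|vabs x| = `|x|.
Proof.
have e : vabs (vabs x) = vabs x by rewrite ge0_vabs//; exact: vabs_ge0.
by apply/le_anti/andP; split; apply: lattice_norm; rewrite e; exact: vle_refl.
Qed.

Lemma norm_vpos x : `|vpos x| <= `|x|.
Proof.
rewrite -[leRHS]norm_vabs; apply: banach_norm_le; first exact: vpos_ge0.
exact: vpos_le_vabs.
Qed.

(* Riesz-Kantorovich: on the positive cone,
   (f \/ g)(x) = sup { f y + g (x - y) | 0 <= y <= x }. *)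
Section riesz_kantorovich.
Variables f g : dual E.

Let S x := [set f y + g (x - y) | y in [set y | 0 <=v y /\ y <=v x]].
Let p x := sup (S x).

Let boundE : exists2 C, 0 <= C &
  forall x y, 0 <=v y -> y <=v x -> `|f y + g (x - y)| <= C * `|x|.
Proof.
have [M M0 fM] := dual_bounded f; have [N N0 gN] := dual_bounded g.
exists (M + N); first exact: addr_ge0.
move=> x y y0 yx; rewrite mulrDl (le_trans (ler_normD _ _))// lerD//.
  by rewrite (le_trans (fM _))// ler_wpM2l//; exact: banach_norm_le.
rewrite (le_trans (gN _))// ler_wpM2l//; apply: banach_norm_le.
  exact/vsubr_ge0.
by apply/vsubr_ge0; rewrite opprB addrCA subrr addr0.
Qed.

Let S_has_sup x : 0 <=v x -> has_sup (S x).
Proof.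
move=> x0; split.
  by exists (f 0 + g (x - 0)); exists 0 => //; split => //; exact: vle_refl.
have [C _ HC] := boundE; exists (C * `|x|) => _ [y [y0 yx] <-].
exact: le_trans (ler_norm _) (HC _ _ y0 yx).
Qed.

Let p_ub x y : 0 <=v y -> y <=v x -> f y + g (x - y) <= p x.
Proof.
move=> y0 yx; apply: ub_le_sup; last by exists y.
by have [] := S_has_sup (vle_trans y0 yx).
Qed.

Let p_least x c : 0 <=v x ->
  (forall y, 0 <=v y -> y <=v x -> f y + g (x - y) <= c) -> p x <= c.
Proof.
move=> x0 H; apply: ge_sup; first by have [] := S_has_sup x0.
by move=> _ [y [y0 yx] <-]; exact: H.
Qed.

Let pD x y : 0 <=v x -> 0 <=v y -> p (x + y) = p x + p y.
Proof.
move=> x0 y0; apply/le_anti/andP; split.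
  apply: p_least; first exact: vaddr_ge0.
  move=> z z0 zxy; have [u [u0 ux] [v0 vy]] := riesz_decomposition x0 y0 z0 zxy.
  have := lerD (p_ub u0 ux) (p_ub v0 vy); apply: le_trans.
  by rewrite addrACA -!linearD/= addrCA subrr addr0 addrACA -opprD addrCA subrr addr0.
rewrite -lerBrDr; apply: p_least => // u u0 ux.
rewrite lerBrDr -lerBrDl; apply: p_least => // v v0 vy.
rewrite lerBrDl.
have -> : f u + g (x - u) + (f v + g (y - v)) = f (u + v) + g (x + y - (u + v)).
  by rewrite addrACA -!linearD/= opprD addrACA.
by apply: p_ub; [exact: vaddr_ge0|exact: vle_add].
Qed.

Let pZ_le (a : R) x : 0 < a -> 0 <=v x -> p (a *: x) <= a * p x.
Proof.
move=> a0 x0; have a0' := ltW a0; have ia0 : 0 <= a^-1 by rewrite invr_ge0.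
apply: p_least; first exact: vscaler_ge0.
move=> y y0 yx; rewrite -ler_pdivrMl// mulrDr.
rewrite -[a^-1 * f y]/(a^-1 *: f y) -[a^-1 * g _]/(a^-1 *: g _) -!linearZ/=.
rewrite scalerBr scalerA mulVf ?gt_eqF// scale1r; apply: p_ub.
  exact: vscaler_ge0.
by move: (vscaler_le ia0 yx); rewrite scalerA mulVf ?gt_eqF// scale1r.
Qed.

Let p0 : p 0 = 0.
Proof.
have := pD (vle_refl (0 : E)) (vle_refl 0).
by rewrite addr0 -[X in X = _]addr0 => /addrI.
Qed.

Let pZ (a : R) x : 0 <= a -> 0 <=v x -> p (a *: x) = a * p x.
Proof.
rewrite le_eqVlt => /predU1P[<- _|a0 x0]; first by rewrite scale0r mul0r p0.
apply/le_anti; rewrite pZ_le//= -ler_pdivlMl//.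
have ia0 : 0 < a^-1 by rewrite invr_gt0.
have := pZ_le ia0 (vscaler_ge0 (ltW a0) x0).
by rewrite scalerA mulVf ?gt_eqF// scale1r.
Qed.

Let q x := p (vpos x) - p (vpos (- x)).

Let qB x y : 0 <=v x -> 0 <=v y -> q (x - y) = p x - p y.
Proof.
move=> x0 y0; set z := x - y.
have e : vpos z + y = x + vpos (- z).
  by rewrite -[vpos z](subrK (vpos (- z))) vposB addrAC subrK.
have := congr1 p e; rewrite !pD//; try exact: vpos_ge0.
by move=> pe; apply/eqP; rewrite /q -/z subr_eq addrAC eq_sym subr_eq pe addrC.
Qed.

Let q_linear : linear q.
Proof.
have qD x y : q (x + y) = q x + q y.
  rewrite -{1}(vposB x) -{1}(vposB y) addrACA -opprD qB; try
    by apply: vaddr_ge0; exact: vpos_ge0.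
  by rewrite !pD; try exact: vpos_ge0; rewrite opprD addrACA.
have qN x : q (- x) = - q x by rewrite /q opprK opprB.
have qZ_ge0 (a : R) x : 0 <= a -> q (a *: x) = a * q x.
  move=> a0; rewrite -{1}(vposB x) scalerBr qB; try
    by apply: vscaler_ge0 => //; exact: vpos_ge0.
  by rewrite !pZ//; try exact: vpos_ge0; rewrite -mulrBr.
move=> a x y; rewrite qD; congr (_ + _).
have [/qZ_ge0//|/ltW a0] := leP 0 a.
by rewrite -[LHS]opprK -qN -scaleNr qZ_ge0 ?oppr_ge0// mulNr opprK.
Qed.

Let q_continuous : continuous q.
Proof.
pose Q : {linear E -> R} := HB.pack q (GRing.isLinear.Build R E R *:%R q q_linear).
apply: (@bounded_linear_continuous R E R Q); apply/linear_boundedP.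
have [C C0 HC] := boundE.
have pC x : 0 <=v x -> `|p x| <= C * `|x|.
  move=> x0; rewrite ler_norml; apply/andP; split.
    apply: (@le_trans _ _ (f 0 + g (x - 0))); last first.
      by apply: p_ub => //; exact: vle_refl.
    by rewrite lerNl (le_trans (ler_norm _))// normrN HC//; exact: vle_refl.
  apply: p_least => // y y0 yx.
  exact: le_trans (ler_norm _) (HC _ _ y0 yx).
near=> r => x; rewrite /= (@le_trans _ _ ((C + C) * `|x|))//.
  rewrite /q (le_trans (ler_normB _ _))// mulrDl lerD// (le_trans (pC _ (vpos_ge0 _)))//.
    by rewrite ler_wpM2l// norm_vpos.
  by rewrite ler_wpM2l// (le_trans (norm_vpos _))// normrN.
by rewrite ler_wpM2r//; near: r; apply: nbhs_pinfty_ge; rewrite num_real.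
Unshelve. all: by end_near. Qed.

Let q_in : q \in @dual_pred R E.
Proof. by rewrite inE. Qed.

Definition dual_join : dual E := Dual q_in.

Let joinE x : 0 <=v x -> dual_join x = p x.
Proof. by move=> x0; rewrite -[x]subr0 /= qB ?p0 ?subr0//; exact: vle_refl. Qed.

Lemma dual_join_ubl : dual_le f dual_join.
Proof.
move=> x x0; rewrite joinE//.
by have := p_ub x0 (vle_refl x); rewrite subrr linear0 addr0.
Qed.

Lemma dual_join_ubr : dual_le g dual_join.
Proof.
move=> x x0; rewrite joinE//.
by have := p_ub (vle_refl 0) x0; rewrite subr0 linear0 add0r.
Qed.

Lemma dual_join_least h : dual_le f h -> dual_le g h -> dual_le dual_join h.
Proof.
move=> fh gh x x0; rewrite joinE//; apply: p_least => // y y0 yx.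
have -> : h x = h y + h (x - y) by rewrite -linearD/= addrCA subrr addr0.
by apply: lerD; [exact: fh|apply: gh; exact/vsubr_ge0].
Qed.

End riesz_kantorovich.

HB.instance Definition _ := Lmodule_isVectorLattice.Build R (dual E)
  dual_le_refl dual_le_anti dual_le_trans dual_le_add2r dual_scaler_ge0
  dual_join_ubl dual_join_ubr dual_join_least.

End dual_lattice.

Definition abs_weak_seminorm (R : realType) (E : banachLatticeType R) (x : E)
  (f : dual E) : R := vabs f (vabs x).

(* dual E with the topology having as subbase the open balls of the seminorms
   abs_weak_seminorm x, i.e. |sigma|(E^*, E). *)
Definition abs_weak_dual (R : realType) (E : banachLatticeType R) : Type := dual E.

Section abs_weak_topology.
Context {R : realType} (E : banachLatticeType R).

Definition abs_weak_ball (x : E) (f : dual E) (e : R) : set (abs_weak_dual E) :=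
  [set g : dual E | abs_weak_seminorm x (g - f) < e].

Definition abs_weak_subbase : set (set (abs_weak_dual E)) :=
  [set B | exists x f e, 0 < e /\ B = abs_weak_ball x f e].

HB.instance Definition _ := Choice.on (abs_weak_dual E).
HB.instance Definition _ :=
  isSubBaseTopological.Build (abs_weak_dual E) abs_weak_subbase id.

Definition dual_unit_ball : set (abs_weak_dual E) :=
  [set f : dual E | dual_norm f <= 1].

End abs_weak_topology.

Definition directed (I : Type) (le : I -> I -> Prop) : Prop :=
  [/\ inhabited I, forall i, le i i,
      forall j i k, le i j -> le j k -> le i k &
      forall i j, exists k, le i k /\ le j k].

Definition vinfimum (R : realType) (E : vectorLatticeType R) (A : set E) (m : E) :
    Prop :=
  (forall x, A x -> m <=v x) /\ (forall l, (forall x, A x -> l <=v x) -> l <=v m).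

(* Every net decreasing to 0 converges to 0 in norm. *)
Definition order_continuous_norm (R : realType) (E : banachLatticeType R) : Prop :=
  forall (I : Type) (le : I -> I -> Prop) (x : I -> E),
    directed le -> (forall i j, le i j -> x j <=v x i) ->
    vinfimum (range x) 0 ->
    forall e : R, 0 < e -> exists i, forall j, le i j -> `|x j| < e.

(* Main.v *)
From HB Require Import structures.
Require Import Defs.
From mathcomp Require Import all_boot all_order all_algebra.
From mathcomp Require Import all_classical all_reals topology normedtype.
From mathcomp Require Import lra.

(** Compactness of the dual ball makes every decreasing net of positive elements
    norm Cauchy, by a Dini-type argument on the ball.

    Let [x i] decrease to [0].  For a single functional [f], the net [f (x i)]
    converges, because [f] is a difference of two positive functionals and each
    of these sends [x i] to a decreasing net bounded below
    ([functional_cvg]).  The limit need not be [0]: only the Cauchy property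
    is used.  Past an index [i0] the differences [x i - x j] stay in the order
    interval between [- x i0] and [x i0], where the values of [g - f] are bounded
    by the seminorm [|g - f| (x i0)] ([ler_abs_weak_seminorm]).  Hence smallness of
    [f (x i - x j)] for late [i] and [j] persists, with the same indices, for
    all [g] in a neighbourhood of [f] in the absolute weak* topology, and
    compactness makes it uniform over the whole dual ball.  By Hahn-Banach
    ([norming_functional]) the supremum over the ball is the norm, so the net is
    norm Cauchy ([compact_ball_net_cauchy]).

    Completeness then yields a norm limit.  As the positive cone is closed
    ([vge0_cvg]), the limit is both nonnegative and a lower bound of the net, so
    it is the infimum [0]. *)

Set Implicit Arguments.
Unset Strict Implicit.
Unset Printing Implicit Defensive.

Import Order.TTheory GRing.Theory Num.Theory.
Import numFieldNormedType.Exports.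

Local Open Scope classical_set_scope.
Local Open Scope ring_scope.

(** * The Hahn-Banach theorem for a sublinear functional *)

Section hahn_banach.
Variables (R : realType) (V : lmodType R) (p : V -> R).
Hypothesis pD : forall x y, p (x + y) <= p x + p y.
Hypothesis pZ : forall a x, 0 <= a -> p (a *: x) = a * p x.

(** Partial linear functionals dominated by [p] are encoded by their graphs, so
    that extension is inclusion and the upper bound of a chain is its union.
    Being the graph of a function is a consequence of domination.  The value at
    [v] is required of nonempty graphs only, because the union of the empty
    chain must qualify. *)
Definition dominated_graph (v : V) : set (set (V * R)) := [set G |
  [/\ forall a x r y s, G (x, r) -> G (y, s) -> G (a *: x + y, a * r + s),
      forall x r, G (x, r) -> r <= p x &
      G !=set0 -> G (v, p v)]].

Let p0 : p 0 = 0.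
Proof. by rewrite -(scale0r 0) pZ// mul0r. Qed.

(** Two values at [x] put [(0, r - s)] and its opposite in the graph, and
    [p 0 = 0] bounds both second components by [0]. *)
Lemma dominated_graph_functional v G x r s :
  dominated_graph v G -> G (x, r) -> G (x, s) -> r = s.
Proof.
move=> [lG dG _].
suff le_rs r' s' : G (x, r') -> G (x, s') -> r' <= s'.
  by move=> Gr Gs; apply/le_anti; rewrite !le_rs.
move=> Gr Gs; have /dG := lG (-1) _ _ _ _ Gs Gr.
by rewrite scaleN1r addNr p0 mulN1r; lra.
Qed.

Lemma dominated_graph_line v :
  dominated_graph v [set (a *: v, a * p v) | a in [set: R]].
Proof.
split=> [a _ _ _ _ [b _ [<- <-]] [c _ [<- <-]]|_ _ [a _ [<- <-]]|_].
- by exists (a * b + c) => //; rewrite scalerDl scalerA mulrDl mulrA.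
- have [a0|a0] := leP 0 a; first by rewrite pZ.
  have := pD (a *: v) (- a *: v).
  by rewrite -scalerDl subrr scale0r p0 [X in _ <= _ + X]pZ; lra.
- by exists 1 => //; rewrite scale1r mul1r.
Qed.

(** The one-dimensional step.  By homogeneity, [r + t * c <= p (x + t *: z)]
    reduces to [t = 1] and [t = -1], that is, to
    [r - p (x - z) <= c <= p (y + z) - s] for all [(x, r)] and [(y, s)] in the
    graph; such a [c] exists because [r + s <= p (x + y)] and [p] is
    subadditive. *)
Lemma dominated_graph_extend v z A :
  dominated_graph v A -> A !=set0 ->
  exists G, [/\ dominated_graph v G, A `<=` G & exists c, G (z, c)].
Proof.
move=> [lA dA vA] /[dup] A0 /vA Av.
have A00 : A (0, 0).
  by have := lA (-1) _ _ _ _ Av Av; rewrite scaleN1r addNr mulN1r addNr.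
pose S := [set u.2 - p (u.1 - z) | u in A].
have S_ub y s : A (y, s) -> ubound S (p (y + z) - s).
  move=> Ays _ [[x r] Axr <-] /=.
  have := lA 1 _ _ _ _ Axr Ays; rewrite scale1r mul1r => /dA.
  have := pD (x - z) (y + z); rewrite addrACA addNr addr0; lra.
have S_sup : has_sup S.
  by split; [exists (0 - p (0 - z)), (0, 0)|exists (p (0 + z) - 0); exact: S_ub].
pose c := sup S.
have c_ub y s : A (y, s) -> s + c <= p (y + z).
  move=> Ays; rewrite -lerBrDl; apply: ge_sup; first by case: S_sup.
  exact: S_ub.
have c_lb y s : A (y, s) -> s - c <= p (y - z).
  move=> Ays; suff : s - p (y - z) <= c by lra.
  by apply: ub_le_sup; [case: S_sup|exists (y, s)].
pose G := [set u : V * R | exists t x r,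
  A (x, r) /\ u = (x + t *: z, r + t * c)].
have AG : A `<=` G.
  by move=> [x r] Axr; exists 0, x, r; rewrite scale0r mul0r !addr0.
exists G; split => //; last first.
  by exists c, 1, 0, 0; rewrite scale1r mul1r !add0r.
have AZ a x r : A (x, r) -> A (a *: x, a * r).
  by move=> Axr; have := lA a _ _ _ _ Axr A00; rewrite !addr0.
split; last by move=> _; exact: AG.
- move=> a _ _ _ _ [t [x [r [Axr [-> ->]]]]] [t' [y [s [Ays [-> ->]]]]].
  exists (a * t + t'), (a *: x + y), (a * r + s); split; first exact: lA.
  congr pair; last by lra.
  by rewrite scalerDr scalerA addrACA -scalerDl.
- move=> _ _ [t [x [r [Axr [-> ->]]]]].
  have [t0|t0|->] := ltgtP t 0; last by rewrite scale0r mul0r !addr0; exact: dA.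
  + have t'0 : 0 < - t by rewrite oppr_gt0.
    have H := c_lb _ _ (AZ (- t)^-1 _ _ Axr).
    rewrite -(ler_pM2l t'0) -(pZ _ (ltW t'0)) scalerBr scalerA mulrBr mulrA in H.
    by move: H; rewrite mulfV ?gt_eqF// scale1r mul1r scaleNr opprK mulNr opprK.
  + have H := c_ub _ _ (AZ t^-1 _ _ Axr).
    rewrite -(ler_pM2l t0) -(pZ _ (ltW t0)) scalerDr scalerA mulrDr mulrA in H.
    by move: H; rewrite mulfV ?gt_eqF// scale1r mul1r.
Qed.

Lemma hahn_banach (v : V) :
  exists f : V -> R, [/\ linear f, forall x, f x <= p x & f v = p v].
Proof.
have [|A [PA maxA]] := @Zorn_bigcup _ (dominated_graph v).
  move=> F FP Ftot; split.
  - move=> a x r y s [B FB Bx] [C FC Cy].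
    have [/(_ _ Bx) Cx|/(_ _ Cy) By] := Ftot _ _ FB FC.
      by exists C => //; have [lC _ _] := FP _ FC; exact: lC.
    by exists B => //; have [lB _ _] := FP _ FB; exact: lB.
  - by move=> x r [B /FP[_ dB _]]; exact: dB.
  - move=> [u [B FB Bu]]; exists B => //.
    by have [_ _] := FP _ FB; apply; exists u.
have A0 : A !=set0.
  apply/set0P/eqP => A0; apply: (maxA _ _ (dominated_graph_line v)).
  rewrite A0; split => // /(_ (v, p v)); apply.
  by exists 1 => //; rewrite scale1r mul1r.
have totA z : exists c, A (z, c).
  have [G [PG AG [c Gzc]]] := dominated_graph_extend z PA A0.
  exists c; apply: contrapT => NA; apply: (maxA G) => //.
  by split => // /(_ _ Gzc).
pose f z := projT1 (cid (totA z)).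
have Af z : A (z, f z) by rewrite /f; case: cid.
have [lA dA vA] := PA.
exists f; split.
- by move=> a x y; apply: (dominated_graph_functional PA (Af _)); exact: lA.
- by move=> x; exact: dA.
- by apply: (dominated_graph_functional PA (Af _)); exact: vA.
Qed.

End hahn_banach.

(** * Norming functionals and the absolute weak* seminorms *)

Lemma norming_functional (R : realType) (E : normedModType R) (x : E) :
  exists2 g : dual E, dual_norm g <= 1 & g x = `|x|.
Proof.
have [||f [fl fp fx]] := @hahn_banach R E (fun y => `|y|) _ _ x.
- exact: ler_normD.
- by move=> a y a0; rewrite normrZ ger0_norm.
pose F : {linear E -> R} := HB.pack f (GRing.isLinear.Build R E R *:%R f fl).
have f_le y : `|f y| <= `|y|.
  rewrite ler_norml fp andbT lerNl; have := fp (- y).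
  by rewrite normrN -[f _]/(F _) linearN.
have f_dual : f \in @dual_pred R E.
  rewrite inE; split => //.
  apply: (@bounded_linear_continuous R E R F); apply/linear_boundedP.
  near=> r => y; rewrite (le_trans (f_le y))// -[leLHS]mul1r ler_wpM2r//.
exists (Dual f_dual) => //; apply: ge_sup.
  by exists `|f 0|, 0 => //=; rewrite normr0.
by move=> _ [y y1 <-]; exact: le_trans (f_le y) y1.
Unshelve. all: by end_near. Qed.

(** With [X = |x|], both [X + y] and [X - y] are nonnegative, so
    [2 f y = f (X + y) - f (X - y) <= |f| (X + y) + |f| (X - y) = 2 |f| X]. *)
Lemma ler_abs_weak_seminorm (R : realType) (E : banachLatticeType R)
    (f : dual E) (x y : E) :
  vabs y <=v vabs x -> `|f y| <= abs_weak_seminorm x f.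
Proof.
move=> yx; rewrite /abs_weak_seminorm; set X := vabs x in yx *.
have le_y : y <=v X by apply: vle_trans yx; exact: vjoin_ubl.
have le_Ny : - y <=v X by apply: vle_trans yx; exact: vjoin_ubr.
have Xy0 : 0 <=v X - y by exact/vsubr_ge0.
have Xy1 : 0 <=v X + y by rewrite -[y]opprK; exact/vsubr_ge0.
have leP (g : dual E) : g <=v vabs f -> g (X + y) <= vabs f (X + y) /\
    g (X - y) <= vabs f (X - y) by move=> gf; split; exact: gf.
have [f1 f2] := leP f (vjoin_ubl _ _).
have [] := leP (- f) (vjoin_ubr _ _).
move: f1 f2; rewrite !dual_oppE !linearB !linearD/= ler_norml => *.
by apply/andP; split; lra.
Qed.

Lemma abs_weak_seminorm0 (R : realType) (E : banachLatticeType R) (x : E) :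
  abs_weak_seminorm x 0 = 0.
Proof. by rewrite /abs_weak_seminorm ge0_vabs//; exact: vle_refl. Qed.

Lemma nbhs_abs_weak_ball (R : realType) (E : banachLatticeType R) (x : E)
    (f : abs_weak_dual E) (e : R) :
  0 < e -> nbhs f (abs_weak_ball x f e).
Proof.
move=> e0; apply: open_nbhs_nbhs; split; last first.
  by rewrite /abs_weak_ball /= subrr abs_weak_seminorm0.
exists [set abs_weak_ball x f e]; last by rewrite bigcup_set1.
move=> _ ->; apply: (@finI_from1 _ _ (abs_weak_subbase (E := E)) id).
by exists x, f, e.
Qed.

(** * The positive cone is norm closed *)

Section closed_cone.
Variables (R : realType) (E : banachLatticeType R).
Implicit Types x y z : E.

(** The negative part of [z] measures its distance to the cone: if [0 <= x],
    then [- z <= x - z <= |z - x|]. *)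
Lemma norm_vpos_oppr_le x z : 0 <=v x -> `|vpos (- z)| <= `|z - x|.
Proof.
move=> x0; rewrite -[leRHS]normrN -[leRHS]norm_vabs opprB.
apply: banach_norm_le; first exact: vpos_ge0.
apply: vjoin_least; last exact: vabs_ge0.
apply: (vle_trans _ (vjoin_ubl _ _)); apply/vsubr_ge0.
by rewrite opprK subrK.
Qed.

Lemma vge0_cvg (F : set_system E) {FF : ProperFilter F} z :
  F --> z -> F [set x | 0 <=v x] -> 0 <=v z.
Proof.
move=> Fz F0.
suff : vpos (- z) = 0.
  move=> z0; rewrite -(vposB z) z0 subr0; exact: vpos_ge0.
apply/eqP; rewrite -normr_le0; apply/ler_addgt0Pr => e e0; rewrite add0r.
have := @cvgr_dist_le _ _ _ F FF id z Fz e e0.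
move=> Fe; have [x [/= x0 xe]] := filter_ex (filterI F0 Fe).
exact: le_trans (norm_vpos_oppr_le z x0) xe.
Qed.

End closed_cone.

(** * Decreasing nets of positive elements *)

Section decreasing_net.
Variables (R : realType) (E : banachLatticeType R).
Variables (I : Type) (le : I -> I -> Prop).
Hypothesis dir : directed le.

Definition tails : set_system I :=
  filter_from [set: I] (fun i => [set j | le i j]).

#[local] Instance tails_proper : ProperFilter tails.
Proof.
have [[i0] le_refl le_trans le_ub] := dir.
apply: filter_from_proper; last by move=> i _; exists i; exact: le_refl.
apply: filter_from_filter; first by exists i0.
move=> i j _ _; have [k [ik jk]] := le_ub i j.
by exists k => // l kl; split; [exact: le_trans ik kl|exact: le_trans jk kl].
Qed.

Variable x : I -> E.
Hypothesis x_dec : forall i j, le i j -> x j <=v x i.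
Hypothesis x_ge0 : forall i, 0 <=v x i.

(** The limit is the infimum of the values of [f] along the net, which may be
    positive. *)
Lemma positive_functional_cvg (f : dual E) :
  0 <=v f -> cvg (f (x i) @[i --> tails]).
Proof.
move=> f0.
have fx_ge0 i : 0 <= f (x i) by exact: f0.
pose S := [set f (x i) | i in [set: I]].
have [[i0] _ _ _] := dir.
have S_inf : has_inf S.
  split; first by exists (f (x i0)), i0.
  by exists 0 => _ [i _ <-].
apply/cvg_ex; exists (inf S); apply/cvgrPdist_lt => e e0.
have [_ [i _ <-] fxi] := inf_adherent e0 S_inf.
exists i => // j /= ij.
have inf_le : inf S <= f (x j) by apply: ge_inf; [case: S_inf|exists j].
have : 0 <= f (x i - x j) by apply: f0; apply/vsubr_ge0; exact: x_dec.
rewrite linearB/= => fij; rewrite ltr_norml; apply/andP; split; lra.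
Qed.

Lemma functional_cvg (f : dual E) : cvg (f (x i) @[i --> tails]).
Proof.
rewrite -(vposB f).
by apply: is_cvgB; apply: positive_functional_cvg; exact: vpos_ge0.
Qed.

(** The near-covering form of compactness turns an estimate that holds for late
    [(i, j)] around each functional into one that holds for late [(i, j)] on the
    whole ball; no finite subcover has to be extracted. *)
Lemma compact_ball_net_cauchy :
  compact (@dual_unit_ball R E) -> cauchy (x i @[i --> tails]).
Proof.
move=> /compact_near_coveringP ball_cov; apply/cauchy_ballP => e e0.
have [[i0] _ _ _] := dir.
have e4 : 0 < e / 4 by lra.
have : \forall ij \near filter_prod tails tails,
    @dual_unit_ball R E `<=`
    [set g : dual E | `|g (x ij.1 - x ij.2)| < e / 2].
  apply: ball_cov => f _.
  (* [e / 4] for the distance from [g] to [f] at [x i0], and [e / 4] for the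
     oscillation of [f] along the net. *)
  exists ([set g : abs_weak_dual E | abs_weak_ball (x i0) f (e / 4) g],
      [set ij | [/\ le i0 ij.1, le i0 ij.2 & `|f (x ij.1 - x ij.2)| < e / 4]]).
    split => /=; first exact: nbhs_abs_weak_ball.
    have /cvg_cauchy/cauchy_ballP/(_ _ e4) := functional_cvg (f := f).
    rewrite near_map2 => near_ij.
    have tails_i0 : tails [set i | le i0 i] by exists i0.
    have near_i0 : filter_prod tails tails [set ij | le i0 ij.1 /\ le i0 ij.2].
      by exists ([set i | le i0 i], [set i | le i0 i]).
    apply: filterS (filterI near_i0 near_ij) => -[i j] /= [[i0i i0j] fij].
    by split => //; rewrite linearB.
  move=> [g [i j]] /= [gf [i0i i0j fij]].
  have ij_le : vabs (x i - x j) <=v vabs (x i0).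
    have le_i0 k l : le i0 k -> x k - x l <=v x i0.
      move=> i0k; apply: vle_trans (x_dec i0k); apply/vsubr_ge0.
      by rewrite opprB addrCA subrr addr0.
    by rewrite (ge0_vabs (x_ge0 _)); apply: vjoin_least; rewrite ?opprB; exact: le_i0.
  have -> : g (x i - x j) = (g - f) (x i - x j) + f (x i - x j).
    by rewrite dual_addE dual_oppE subrK.
  apply: le_lt_trans (ler_normD _ _) _.
  have gfij := le_lt_trans (ler_abs_weak_seminorm (g - f) ij_le) gf.
  by lra.
rewrite near_map2; apply: filterS => -[i j] /= ball_ij.
have [g gB gij] := norming_functional (x i - x j).
have := ball_ij _ gB; rewrite /= gij normr_id => ije.
by rewrite -ball_normE /=; lra.
Qed.

Lemma compact_ball_net_cvg0 :
  compact (@dual_unit_ball R E) -> vinfimum (range x) 0 ->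
  x i @[i --> tails] --> 0.
Proof.
move=> /compact_ball_net_cauchy/cauchy_cvgP/cvg_ex[z xz] [_ x_inf].
suff <- : z = 0 by [].
have [[i0] _ _ _] := dir.
apply: vle_anti; last by apply: (vge0_cvg xz); exists i0 => // j _; exact: x_ge0.
apply: x_inf => _ [i _ <-]; apply/vsubr_ge0.
apply: (@vge0_cvg _ _ (x i - x j @[j --> tails])).
  by apply: cvgB => //; exact: cvg_cst.
by exists i => // j /= ij; apply/vsubr_ge0; exact: x_dec.
Qed.

End decreasing_net.

Theorem proposition2p6 (R : realType) (E : banachLatticeType R) :
  compact (@dual_unit_ball R E) -> order_continuous_norm E.
Proof.
move=> ballK I le x dir x_dec x_inf e e0.
have x_ge0 i : 0 <=v x i by apply: x_inf.1; exists i.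
have := compact_ball_net_cvg0 dir x_dec x_ge0 ballK x_inf.
move=> /(@cvgrPdist_lt _ _ _ _ (tails_proper dir)) /(_ e e0)[i _ xe]; exists i => j /xe /=.
by rewrite sub0r normrN.
Qed.
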